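(* Let $T\subsetneq\{1,\dots,d\}$ (so $|T|<d$), let $x_0\in\mathbb{R}^d$ be a vector with $\operatorname{supp} x_0=T$, and let $\mathcal{S}=(S_i)_{i=1}^k$ be a partition of $\{1,\dots,d\}$ such that $S_i\cap T\neq\emptyset$ for every $i$. Then there exist weights $\omega^*\in\mathbb{R}_+^k$ which minimize, over all $\omega=(\omega_1,\dots,\omega_k)\in\mathbb{R}_+^k$, the quantity $$\tilde m_{\mathcal{S},T,w}=\inf_{\tau>0}\ \mathbb{E}\left(d^{-1}\operatorname{dist}^2\big(g,\tau\cdot\partial_{x_0}\|\cdot\|_{1,w}\big)\right),\qquad w=\sum_{i=1}^k\omega_i 1_{S_i}.$$ Moreover, the minimizing weights $\omega^*$ are uniquely determined by the additional constraint $\|\omega^*\|_\infty=1$ (that is, there is exactly one minimizer $\omega^*\in\mathbb{R}_+^k$ with $\|\omega^*\|_\infty=1$).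
   Context: Here $\mathbb{R}_+=[0,\infty)$, $1_{S_i}\in\mathbb{R}^d$ is the indicator vector of $S_i$, and $g$ is a standard Gaussian vector in $\mathbb{R}^d$. For $w\in\mathbb{R}^d$ with nonnegative entries, $\|x\|_{1,w}=\sum_{j=1}^d w_j|x(j)|$. $\partial_{x_0}f$ denotes the subdifferential of the convex function $f$ at $x_0$, i.e. the set of $p\in\mathbb{R}^d$ with $f(x_0+v)\ge f(x_0)+\langle p,v\rangle$ for all $v\in\mathbb{R}^d$. $\operatorname{dist}(g,M)$ is the Euclidean distance from $g$ to the set $M$, and $\tau\cdot M=\{\tau p: p\in M\}$. *)

(* Defs.v *)
From HB Require Import structures.
From mathcomp Require Import all_boot all_order all_algebra.
From mathcomp Require Import all_classical all_reals all_analysis.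

Set Implicit Arguments.
Unset Strict Implicit.
Unset Printing Implicit Defensive.

Import Order.TTheory GRing.Theory Num.Theory.
Import numFieldNormedType.Exports.

Local Open Scope classical_set_scope.
Local Open Scope ring_scope.

(* On 'rV[R]_n the library's norm `|x| is the sup norm, so the Euclidean norm
   and distance are defined here. *)

Definition dotp (R : realType) (n : nat) (x y : 'rV[R]_n) : R :=
  \sum_(j < n) x 0 j * y 0 j.

Definition eucl_norm (R : realType) (n : nat) (x : 'rV[R]_n) : R :=
  Num.sqrt (\sum_(j < n) x 0 j ^+ 2).

(* meaningful for nonempty M only, as the library sets inf set0 = 0 *)
Definition eucl_dist (R : realType) (n : nat) (x : 'rV[R]_n) (M : set 'rV[R]_n)
  : R := inf [set eucl_norm (x - p) | p in M].

Definition supp (R : realType) (n : nat) (x : 'rV[R]_n) : set 'I_n :=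
  [set j | x 0 j != 0].

Definition indic_vec (R : realType) (n : nat) (A : set 'I_n) : 'rV[R]_n :=
  \row_(j < n) \1_A j.

Definition wnorm1 (R : realType) (n : nat) (w x : 'rV[R]_n) : R :=
  \sum_(j < n) w 0 j * `|x 0 j|.

Definition subdifferential (R : realType) (n : nat) (f : 'rV[R]_n -> R)
    (x0 : 'rV[R]_n) : set 'rV[R]_n :=
  [set p | forall v : 'rV[R]_n, f x0 + dotp p v <= f (x0 + v)].

Definition dilate (R : realType) (n : nat) (tau : R) (M : set 'rV[R]_n)
  : set 'rV[R]_n := [set tau *: p | p in M].

Section gaussian_vector.
Context (disp : measure_display) (Omega : measurableType disp) (R : realType).
Context (P : probability Omega R) (n : nat).
Implicit Type g : 'I_n -> {RV P >-> R}.

Definition mutually_independent g : Prop :=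
  forall (J : {set 'I_n}) (A : 'I_n -> set R),
    (forall j, measurable (A j)) ->
    P (\bigcap_(j in [set` J]) (g j @^-1` A j)) =
    (\prod_(j in J) P (g j @^-1` A j))%E.

(* the law is compared on Borel sets only: the library's measures are functions
   on all sets, with no meaning outside the sigma-algebra *)
Definition standard_gaussian g : Prop :=
  (forall (j : 'I_n) (A : set R), measurable A ->
     distribution P (g j) A = normal_prob 0 1 A) /\
  mutually_independent g.

Definition vec_of g (t : Omega) : 'rV[R]_n := \row_(j < n) g j t.

Definition mtilde g (x0 w : 'rV[R]_n) : \bar R :=
  ereal_inf
    [set ('E_P[(fun t : Omega => n%:R^-1 *
                 eucl_dist (vec_of g t)
                   (dilate tau (subdifferential (wnorm1 w) x0)) ^+ 2)%R])%E
    | tau in [set tau : R | 0 < tau]].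

End gaussian_vector.

Definition weight_vec (R : realType) (n k : nat) (S : 'I_k -> set 'I_n)
    (omega : 'rV[R]_k) : 'rV[R]_n :=
  \sum_(i < k) omega 0 i *: indic_vec R (S i).

Definition nonneg_vec (R : realType) (k : nat) (omega : 'rV[R]_k) : Prop :=
  forall i, 0 <= omega 0 i.

Definition optimal_weights (disp : measure_display)
    (Omega : measurableType disp) (R : realType) (P : probability Omega R)
    (n k : nat) (g : 'I_n -> {RV P >-> R}) (x0 : 'rV[R]_n)
    (S : 'I_k -> set 'I_n) (omega : 'rV[R]_k) : Prop :=
  nonneg_vec omega /\
  forall omega' : 'rV[R]_k, nonneg_vec omega' ->
    (mtilde g x0 (weight_vec S omega) <= mtilde g x0 (weight_vec S omega'))%E.

(* Main.v *)
Require Import Defs.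
From mathcomp Require Import all_boot all_order all_algebra.
From mathcomp Require Import all_classical all_reals all_analysis.
From mathcomp Require Import measurable_realfun ring lra.

(** Only the products [tau * omega_i] matter: the infimum over [tau] means that
    [omega] is judged by the best point on the open ray through it.

    The subdifferential of the weighted norm at [x0] is a box: its [j]-th factor
    is the point [w_j * sg (x0_j)] on the support and the segment from [- w_j]
    to [w_j] off it ([subdifferential_wnorm1P]). Hence the squared distance
    splits over coordinates ([eucl_dist_dilate_subdifferential]), and since a
    standard Gaussian variable has mean 0, a coordinate of the support
    contributes [v + a ^+ 2] to the expectation, with [v] the second moment,
    while a coordinate off the support contributes [mean_sqdist a], the mean
    squared distance of the Gaussian to the segment from [- a] to [a]; here
    [a = tau * w_j]. Grouping the coordinates by blocks, the expectation at
    [u = tau *: omega] is, up to the factor [1 / d], a sum over [i] of functions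
    [n_i * (v + u_i ^+ 2) + m_i * mean_sqdist u_i] of one variable each, where
    [n_i] and [m_i] count the coordinates of block [i] on and off the support
    ([sum_mean_coord_cost]).

    Every block meets the support, so [n_i >= 1]; as [mean_sqdist] is convex,
    each summand is strongly convex and has a minimizer [u_i >= 0], away from
    which it grows quadratically ([block_cost_min], [block_cost_growth]). As the
    support is proper, some [m_i] is positive, and there [u_i] is nonzero
    because [mean_sqdist] has a negative slope at 0 ([block_cost_min_neq0]). So
    the vector [u] is nonzero and it is the unique minimizer; the optimal
    weights are exactly its positive multiples, and one of them has sup norm 1
    ([unique_normalized_ray_minimizer]). *)

Set Implicit Arguments.
Unset Strict Implicit.
Unset Printing Implicit Defensive.

Import Order.TTheory GRing.Theory Num.Theory.
Import numFieldNormedType.Exports.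
Local Open Scope classical_set_scope.
Local Open Scope ring_scope.

(** * Moments of the standard Gaussian *)

(** Both the Radon-Nikodym derivative and the density integrate to the measure
    of every Borel set, so they agree almost everywhere. *)
Lemma ge0_integral_normal_prob (R : realType) (m s : R) (f : R -> \bar R) :
  s != 0 -> measurable_fun [set: R] f -> (forall x, 0 <= f x)%E ->
  (\int[normal_prob m s]_x f x =
   \int[lebesgue_measure]_x (f x * (normal_pdf m s x)%:E))%E.
Proof.
move=> s0 mf f0.
have dom := normal_prob_dominates m s.
rewrite -(Radon_Nikodym_SigmaFinite.change_of_variables dom)//.
have rn_int := Radon_Nikodym_SigmaFinite.f_integrable dom.
have mpdf : measurable_fun [set: R] (fun x => (normal_pdf m s x)%:E).
  by apply/measurable_EFinP; exact: measurable_normal_pdf.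
apply: ae_eq_integral => //.
- by apply: emeasurable_funM => //; exact: measurable_int rn_int.
- exact: emeasurable_funM.
- apply: ae_eqe_mul2l; apply: integral_ae_eq => // E _ mE.
  by rewrite -Radon_Nikodym_SigmaFinite.f_integral.
Qed.

Lemma normal_prob_opp (R : realType) (s : R) (A : set R) :
  s != 0 -> measurable A ->
  pushforward (normal_prob 0 s) (-%R : _ -> measurableTypeR R) A =
  normal_prob 0 s A.
Proof.
move=> s0 mA; rewrite /pushforward /normal_prob.
have mopp : measurable_fun setT (-%R : measurableTypeR R -> measurableTypeR R).
  exact: oppr_measurable.
have mpdf : measurable_fun A (fun x => (normal_pdf 0 s x)%:E).
  apply: measurable_funTS; apply/measurable_EFinP.
  exact: measurable_normal_pdf.
transitivity (\int[lebesgue_measure]_(x in -%R @^-1` A)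
   (((fun x => (normal_pdf 0 s x)%:E) \o
      (-%R : measurableTypeR R -> measurableTypeR R)) x))%E.
  apply: eq_integral => x _ /=.
  by rewrite !normal_pdfE// /normal_fun !subr0 sqrrN.
rewrite -(ge0_integral_pushforward mopp)//; last first.
  by move=> y _; rewrite lee_fin normal_pdf_ge0.
by apply: eq_measure_integral => //= B mB _; exact: lebesgue_measureN.
Qed.

(** The density of standard deviation 2 serves as an integrable majorant:
    [x ^+ 2 * exp(- x ^+ 2 / 2)] is at most [8 / 3 * exp(- x ^+ 2 / 8)],
    because [t <= exp t] at [t = 3 / 8 * x ^+ 2]. *)
Lemma integrable_sqr_normal_prob (R : realType) :
  (@normal_prob R 0 1).-integrable [set: R] (fun x => (x ^+ 2)%:E).
Proof.
have mf : measurable_fun [set: R] (fun x : R => (x ^+ 2)%:E).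
  by apply/measurable_EFinP; exact: measurable_funX.
apply/integrableP; split => //.
rewrite (_ : (fun x => `|(x ^+ 2)%:E|) =
    (fun x : R => (x ^+ 2)%:E))%E; last first.
  by apply/funext => x /=; rewrite ger0_norm ?sqr_ge0.
rewrite ge0_integral_normal_prob ?oner_eq0//=.
(* the ratio of the two normalizing constants times the 8 / 3 above *)
pose C : R := 8 / 3 * normal_peak 1 / normal_peak 2.
have p1 : 0 < normal_peak (1 : R) by rewrite normal_peak_gt0 ?oner_eq0.
have p2 : 0 < normal_peak (2 : R) by rewrite normal_peak_gt0 ?pnatr_eq0.
have C0 : 0 <= C.
  by apply: divr_ge0; [apply: mulr_ge0; [lra|exact: ltW]|exact: ltW].
apply: (@le_lt_trans _ _
    (\int[lebesgue_measure]_x (C%:E * (normal_pdf 0 2 x)%:E))%E); last first.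
  rewrite ge0_integralZl//=.
  - by rewrite integral_normal_pdf mule1 ltry.
  - by apply/measurable_EFinP; exact: measurable_normal_pdf.
  - by move=> x _; rewrite lee_fin normal_pdf_ge0.
apply: ge0_le_integral => //=.
- by move=> x _; rewrite lee_fin mulr_ge0 ?sqr_ge0 ?normal_pdf_ge0.
- apply: emeasurable_funM => //.
  by apply/measurable_EFinP; exact: measurable_normal_pdf.
- apply: emeasurable_funM => //.
  by apply/measurable_EFinP; exact: measurable_normal_pdf.
- move=> x _; rewrite lee_fin !normal_pdfE ?pnatr_eq0 ?oner_eq0//.
  rewrite /normal_fun !subr0.
  have -> : - x ^+ 2 / (1 ^+ 2 *+ 2) =
            - (3 / 8 * x ^+ 2) + - x ^+ 2 / (2 ^+ 2 *+ 2) :> R.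
    by field.
  rewrite expRD /C.
  have -> : 8 / 3 * normal_peak 1 / normal_peak 2 *
     (normal_peak 2 * expR (- x ^+ 2 / (2 ^+ 2 *+ 2))) =
     8 / 3 * (normal_peak 1 * expR (- x ^+ 2 / (2 ^+ 2 *+ 2))).
    by field; rewrite gt_eqF.
  rewrite [leLHS](_ : _ = (x ^+ 2 * expR (- (3 / 8 * x ^+ 2))) *
     (normal_peak 1 * expR (- x ^+ 2 / (2 ^+ 2 *+ 2)))); last by ring.
  apply: ler_wpM2r; first by apply: mulr_ge0; [exact: ltW|exact: expR_ge0].
  rewrite expRN ler_pdivrMr ?expR_gt0//.
  have := expR_ge1Dx (3 / 8 * x ^+ 2); lra.
by move=> x; rewrite lee_fin sqr_ge0.
Qed.

Lemma integrable_id_normal_prob (R : realType) :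
  (@normal_prob R 0 1).-integrable [set: R] (fun x => x%:E).
Proof.
have iG : (@normal_prob R 0 1).-integrable [set: R]
    (cst 1 \+ (fun x : R => (x ^+ 2)%:E))%E.
  apply: integrableD => //; last exact: integrable_sqr_normal_prob.
  exact: finite_measure_integrable_cst.
apply: le_integrable iG => //.
- exact/measurable_EFinP.
- move=> x _; rewrite /= lee_fin [leRHS]ger0_norm ?addr_ge0 ?sqr_ge0//.
  by rewrite ler_norml; apply/andP; split; nra.
Qed.

Lemma integrable_abs_normal_prob (R : realType) :
  (@normal_prob R 0 1).-integrable [set: R] (fun x => `|x|%:E).
Proof. exact: (integrable_norm (integrable_id_normal_prob R)). Qed.

(** The measure is invariant under negation, so the mean equals its opposite. *)
Lemma mean_normal_prob (R : realType) : \int[@normal_prob R 0 1]_x x = 0.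
Proof.
have iI := integrable_id_normal_prob R.
have iN : (@normal_prob R 0 1).-integrable [set: R]
    ((fun x : R => x%:E) \o (-%R : measurableTypeR R -> measurableTypeR R)).
  have := integrableZl measurableT (-1) iI.
  by apply: eq_integrable => // x _; rewrite /= -EFinM mulN1r.
have mopp : measurable_fun setT (-%R : measurableTypeR R -> measurableTypeR R).
  exact: oppr_measurable.
have mE : measurable_fun [set: R] (fun x : R => x%:E) by exact/measurable_EFinP.
have : \int[@normal_prob R 0 1]_x x = \int[@normal_prob R 0 1]_x (-1 * x).
  rewrite /Rintegral; congr fine.
  transitivity (\int[pushforward (@normal_prob R 0 1)
     (-%R : measurableTypeR R -> measurableTypeR R)]_x x%:E)%E.
    apply: eq_measure_integral => A mA _.
    by apply/esym/normal_prob_opp; rewrite ?oner_eq0.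
  rewrite (integral_pushforward mopp mE iN)//.
  by apply: eq_integral => x _; rewrite /= mulN1r.
rewrite RintegralZl// mulN1r => /eqP.
by rewrite -addr_eq0 -mulr2n mulrn_eq0 => /eqP.
Qed.

(** Otherwise the whole mass would sit at 0, a Lebesgue-null set. *)
Lemma mean_abs_normal_prob_gt0 (R : realType) :
  0 < \int[@normal_prob R 0 1]_x `|x|.
Proof.
have iA := integrable_abs_normal_prob R.
rewrite lt_neqAle Rintegral_ge0 ?andbT//.
apply/eqP => /esym E0.
have mE : measurable_fun [set: R] (fun x : R => x%:E) by exact/measurable_EFinP.
have : (\int[@normal_prob R 0 1]_x `|x%:E| = 0)%E.
  rewrite -[LHS]fineK; first by rewrite [fine _]E0.
  exact: (integrable_fin_num measurableT iA).
move/(ae_eq_integral_abs (normal_prob 0 1) measurableT mE) => [N [mN N0 subN]].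
have m0 : measurable [set 0 : R] by exact: measurable_set1.
have n0 : normal_prob 0 1 [set 0 : R] = 0%E.
  have := normal_prob_dominates (0 : R) 1.
  move/null_content_dominatesP; apply => //; exact: lebesgue_measure_set1.
have : (normal_prob 0 1 [set: R] <=
        normal_prob 0 1 N + normal_prob 0 1 [set 0%R])%E.
  apply: le_trans (measureU2 _ mN m0).
  apply: le_measure; rewrite ?inE//; first exact: measurableU.
  move=> x _; have [->|x0] := eqVneq x 0; first by right.
  left; apply: subN => /= /(_ I) [] /eqP.
  by rewrite (negbTE x0).
rewrite n0 N0 adde0 probability_setT.
by rewrite lee_fin ler10.
Qed.

(** * Mean squared distance of a Gaussian to a point and to a segment *)

(** The squared distance from [x] to the segment from [- a] to [a], when
    [0 <= a]. *)
Definition sqdist_seg (R : realType) (a x : R) : R := Num.max 0 (`|x| - a) ^+ 2.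

Lemma sqdist_seg_ge0 (R : realType) (a x : R) : 0 <= sqdist_seg a x.
Proof. exact: sqr_ge0. Qed.

Lemma sqdist_seg0 (R : realType) (x : R) : sqdist_seg 0 x = x ^+ 2.
Proof. by rewrite /sqdist_seg subr0 max_r// real_normK ?num_real. Qed.

Lemma sqdist_seg_le_sqr (R : realType) (a x : R) :
  0 <= a -> sqdist_seg a x <= x ^+ 2.
Proof.
move=> a0; rewrite /sqdist_seg -(real_normK (num_real x)).
move: `|x| (normr_ge0 x) => {x} y y0.
by case: (leP 0 (y - a)) => ?; nra.
Qed.

Lemma sqdist_seg_le_shift (R : realType) (a x : R) :
  sqdist_seg a x <= x ^+ 2 - 2 * a * `|x| + a ^+ 2.
Proof.
rewrite /sqdist_seg -(real_normK (num_real x)).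
move: `|x| (normr_ge0 x) => {x} y y0.
by case: (leP 0 (y - a)) => ?; nra.
Qed.

(** The positive part is convex and the square is convex and increasing on the
    nonnegative reals. *)
Lemma sqdist_seg_mid (R : realType) (a b x : R) :
  sqdist_seg ((a + b) / 2) x <= (sqdist_seg a x + sqdist_seg b x) / 2.
Proof.
rewrite /sqdist_seg; move: `|x| => {x} y.
have h (p q : R) : p <= Num.max 0 p /\ 0 <= Num.max 0 q.
  by split; rewrite le_max lexx ?orbT.
have [] := h (y - a) (y - a); have [] := h (y - b) (y - b).
move: (Num.max 0 (y - a)) (Num.max 0 (y - b)) => p q *.
have : Num.max 0 (y - (a + b) / 2) <= (p + q) / 2.
  by rewrite ge_max; apply/andP; split; lra.
have := proj2 (h 0 (y - (a + b) / 2)).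
move: (Num.max _ _) => r r0 rpq.
have : r ^+ 2 <= ((p + q) / 2) ^+ 2 by apply: lerXn2r; rewrite ?nnegrE//; lra.
have := sqr_ge0 (p - q); nra.
Qed.

Lemma sqdist_seg_lip (R : realType) (a b x : R) : 0 <= a -> a <= b ->
  sqdist_seg b x <= sqdist_seg a x /\
  sqdist_seg a x <= sqdist_seg b x + 2 * (b - a) * `|x|.
Proof.
rewrite /sqdist_seg; move: `|x| (normr_ge0 x) => {x} y *.
by case: (leP 0 (y - a)) => ?; case: (leP 0 (y - b)) => ?; split; nra.
Qed.

Lemma measurable_sqdist_seg (R : realType) (a : R) :
  measurable_fun [set: R] (sqdist_seg a).
Proof.
apply: measurable_funX; apply: measurable_maxr => //.
by apply: measurable_funB => //; exact: measurable_normr.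
Qed.

Lemma integrable_sqdist_seg (R : realType) (a : R) : 0 <= a ->
  (@normal_prob R 0 1).-integrable [set: R] (EFin \o sqdist_seg a).
Proof.
move=> a0; apply: le_integrable (integrable_sqr_normal_prob R) => //.
- by apply/measurable_EFinP; exact: measurable_sqdist_seg.
- move=> x _; rewrite /= lee_fin !ger0_norm ?sqdist_seg_ge0 ?sqr_ge0//.
  exact: sqdist_seg_le_sqr.
Qed.

(** [mean_sqdist 0] is the second moment of the standard Gaussian. *)
Definition mean_sqdist (R : realType) (a : R) : R :=
  \int[@normal_prob R 0 1]_x sqdist_seg a x.

Lemma mean_sqdist_ge0 (R : realType) (a : R) : 0 <= mean_sqdist a.
Proof. by apply: Rintegral_ge0 => x _; exact: sqdist_seg_ge0. Qed.

Lemma mean_sqdist_mid (R : realType) (a b : R) : 0 <= a -> 0 <= b ->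
  mean_sqdist ((a + b) / 2) <= (mean_sqdist a + mean_sqdist b) / 2.
Proof.
move=> a0 b0; rewrite /mean_sqdist.
have ia := integrable_sqdist_seg a0; have ib := integrable_sqdist_seg b0.
rewrite -RintegralD// -RintegralZr//; last first.
  rewrite (_ : EFin \o _ =
    ((EFin \o sqdist_seg a) \+ (EFin \o sqdist_seg b))%E)//.
  exact: integrableD.
apply: le_Rintegral => //.
- by apply: integrable_sqdist_seg; lra.
- rewrite (_ : EFin \o _ =
    (((EFin \o sqdist_seg a) \+ (EFin \o sqdist_seg b)) \* cst (2^-1)%:E)%E)//.
  by apply: integrableZr => //; apply: integrableD.
- by move=> x _; exact: sqdist_seg_mid.
Qed.

(** On the nonnegative reals the integrand is Lipschitz in [a] with constant
    [2 * `|x|], which is integrable. *)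
Lemma mean_sqdist_lip (R : realType) (a b : R) : 0 <= a -> 0 <= b ->
  `|mean_sqdist a - mean_sqdist b| <=
  2 * (\int[@normal_prob R 0 1]_x `|x|) * `|a - b|.
Proof.
wlog ab : a b / a <= b.
  move=> h a0 b0; case: (leP a b) => [ab|/ltW ba]; first exact: h.
  by rewrite distrC (distrC a); exact: h.
move=> a0 b0; rewrite /mean_sqdist.
have ia := integrable_sqdist_seg a0; have ib := integrable_sqdist_seg b0.
have iA := integrable_abs_normal_prob R.
have iC : (@normal_prob R 0 1).-integrable [set: R]
  (EFin \o (fun x => 2 * (b - a) * `|x|)).
  rewrite (_ : EFin \o _ = (fun x : R => (2 * (b - a))%:E * `|x|%:E)%E)//.
  exact: integrableZl.
rewrite ger0_norm; last first.
  rewrite subr_ge0; apply: le_Rintegral => // x _.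
  by have [] := sqdist_seg_lip x a0 ab.
rewrite distrC ger0_norm ?subr_ge0// lerBlDl.
rewrite -mulrA [X in _ + 2 * X]mulrC mulrA -RintegralZl// -RintegralD//.
apply: le_Rintegral => //.
- rewrite (_ : EFin \o _ = ((EFin \o sqdist_seg b) \+
    (EFin \o (fun x => (2 * (b - a) * `|x|)%R)))%E)//.
  exact: integrableD.
- by move=> x _; have [] := sqdist_seg_lip x a0 ab.
Qed.

(** The slope of [mean_sqdist] at 0 is negative: widening the segment by [a]
    gains [2 * a] times the mean of [`|x|], up to second order. This is what
    keeps the optimal weight of a block away from 0. *)
Lemma mean_sqdist_decrease (R : realType) (a : R) : 0 <= a ->
  mean_sqdist a <=
  mean_sqdist 0 - 2 * a * (\int[@normal_prob R 0 1]_x `|x|) + a ^+ 2.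
Proof.
move=> a0; rewrite /mean_sqdist.
have ia := integrable_sqdist_seg a0.
have i0 := integrable_sqdist_seg (lexx (0 : R)).
have iA := integrable_abs_normal_prob R.
have iC : (@normal_prob R 0 1).-integrable [set: R]
  (EFin \o (fun x => 2 * a * `|x|)).
  rewrite (_ : EFin \o _ = (fun x : R => (2 * a)%:E * `|x|%:E)%E)//.
  exact: integrableZl.
have iD : (@normal_prob R 0 1).-integrable [set: R]
    (EFin \o (fun x => a ^+ 2 + sqdist_seg 0 x)).
  rewrite (_ : EFin \o _ = (cst (a ^+ 2)%:E \+ (EFin \o sqdist_seg 0))%E)//.
  apply: integrableD => //; exact: finite_measure_integrable_cst.
have : \int[@normal_prob R 0 1]_x (sqdist_seg a x + 2 * a * `|x|) <=
       \int[@normal_prob R 0 1]_x (a ^+ 2 + sqdist_seg 0 x).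
  apply: le_Rintegral => //.
    rewrite (_ : EFin \o _ =
      ((EFin \o sqdist_seg a) \+ (EFin \o (fun x => (2 * a * `|x|)%R)))%E)//.
    exact: integrableD.
  move=> x _; have := sqdist_seg_le_shift a x.
  by rewrite sqdist_seg0; lra.
rewrite !RintegralD//; last exact: finite_measure_integrable_cst.
rewrite RintegralZl// Rintegral_cst// [fine _](_ : _ = 1); last first.
  rewrite (_ : _ [set: _] = 1%E)//.
  exact: (@probability_setT _ _ _ (normal_prob 0 1)).
by rewrite mulr1 -lerBrDr [X in X - _]addrC addrAC.
Qed.

(** Composing with the absolute value extends [mean_sqdist] from the nonnegative
    reals, where it is Lipschitz, to a function continuous everywhere. *)
Lemma continuous_mean_sqdist_norm (R : realType) :
  continuous (fun a : R => mean_sqdist `|a|).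
Proof.
move=> a; apply/cvgrPdist_le => /= e e0.
have := ltW (mean_abs_normal_prob_gt0 R).
have lip (b : R) := mean_sqdist_lip (normr_ge0 a) (normr_ge0 b).
move: (Rintegral _ _ _) lip => K lip K0.
near=> b; apply: le_trans (lip b) _.
have ab : `|a - b| <= e / (2 * K + 1).
  near: b; apply: cvgr_dist_le; first exact: cvg_id.
  by rewrite divr_gt0//; lra.
have K2 : 0 <= 2 * K by lra.
apply: le_trans (ler_wpM2l K2 (le_trans (ler_dist_dist _ _) ab)) _.
by rewrite mulrCA ler_piMr ?(ltW e0)// ler_pdivrMr; lra.
Unshelve. all: by end_near. Qed.

Lemma mean_sqr_shift (R : realType) (b : R) :
  \int[@normal_prob R 0 1]_x (x - b) ^+ 2 = mean_sqdist 0 + b ^+ 2.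
Proof.
have i0 := integrable_sqdist_seg (lexx (0 : R)).
have iI := integrable_id_normal_prob R.
have iC : (@normal_prob R 0 1).-integrable [set: R] (EFin \o cst (b ^+ 2)).
  exact: finite_measure_integrable_cst.
have iL : (@normal_prob R 0 1).-integrable [set: R]
    (EFin \o (fun x => - 2 * b * x)).
  rewrite (_ : EFin \o _ = (fun x : R => (- 2 * b)%:E * x%:E)%E)//.
  exact: integrableZl.
have iLC : (@normal_prob R 0 1).-integrable [set: R]
    (EFin \o (fun x => - 2 * b * x + b ^+ 2)).
  rewrite (_ : EFin \o _ = ((EFin \o (fun x => (- 2 * b * x)%R)) \+
    (EFin \o cst (b ^+ 2)%R))%E)//.
  exact: integrableD.
transitivity
  (\int[@normal_prob R 0 1]_x (sqdist_seg 0 x + (- 2 * b * x + b ^+ 2))).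
  by apply: eq_Rintegral => x _; rewrite sqdist_seg0; ring.
rewrite RintegralD// RintegralD// RintegralZl// mean_normal_prob mulr0 add0r.
congr (_ + _); rewrite Rintegral_cst// [fine _](_ : _ = 1) ?mulr1//.
rewrite (_ : _ [set: _] = 1%E)//.
exact: (@probability_setT _ _ _ (normal_prob 0 1)).
Qed.

(** * Minimizing the cost of one block *)

(** The contribution of a block holding [n] coordinates of the support and [m]
    others when its scaled weight is [a]. *)
Definition block_cost (R : realType) (n m : nat) (a : R) : R :=
  n%:R * (mean_sqdist 0 + a ^+ 2) + m%:R * mean_sqdist a.

(** Beyond [M] the quadratic term alone exceeds the value at 0, so a minimum
    over the compact segment from 0 to [M] is global. *)
Lemma block_cost_min (R : realType) (n m : nat) : (0 < n)%N ->
  exists2 a : R, 0 <= a &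
    forall b, 0 <= b -> block_cost n m a <= block_cost n m b.
Proof.
move=> n0.
have n1 : 1 <= n%:R :> R by rewrite ler1n.
have m0 : 0 <= m%:R :> R by [].
have r0 := mean_sqdist_ge0 (0 : R).
pose M : R := 1 + m%:R * mean_sqdist 0.
have M1 : 1 <= M by rewrite /M lerDl mulr_ge0.
have cont : continuous (fun a : R =>
    n%:R * (mean_sqdist 0 + a ^+ 2) + m%:R * mean_sqdist `|a|).
  move=> a; apply: cvgD; apply: cvgM; try exact: cvg_cst.
  - by apply: cvgD; [exact: cvg_cst|exact: exprn_continuous].
  - exact: continuous_mean_sqdist_norm.
have [||a] := @EVT_min R (fun a : R =>
    n%:R * (mean_sqdist 0 + a ^+ 2) + m%:R * mean_sqdist `|a|) 0 M.
- by rewrite (le_trans _ M1).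
- exact: continuous_subspaceT.
rewrite in_itv/= => /andP[a0 aM] amin; exists a => // b b0.
have [bM|Mb] := leP b M.
  have := amin b; rewrite in_itv/= b0 bM => /(_ isT).
  by rewrite /block_cost !ger0_norm.
have := amin 0; rewrite in_itv/= lexx (le_trans _ M1)// => /(_ isT).
rewrite (ger0_norm a0) normr0 => /le_trans; apply.
have rb := mean_sqdist_ge0 b; rewrite expr0n addr0 /block_cost.
have : m%:R * mean_sqdist 0 <= b ^+ 2 by rewrite /M in M1 Mb; nra.
have : 0 <= m%:R * mean_sqdist b by rewrite mulr_ge0.
have : b ^+ 2 <= n%:R * b ^+ 2 by rewrite ler_peMl// sqr_ge0.
lra.
Qed.

(** Strong convexity at a minimizer, obtained by comparing its value with the
    one at the midpoint of [a] and [b]: the quadratic term loses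
    [n * (b - a) ^+ 2 / 4] there and the other term is midpoint convex. *)
Lemma block_cost_growth (R : realType) (n m : nat) (a b : R) : (0 < n)%N ->
  0 <= a -> 0 <= b ->
  (forall c, 0 <= c -> block_cost n m a <= block_cost n m c) ->
  block_cost n m a + (b - a) ^+ 2 / 2 <= block_cost n m b.
Proof.
move=> n0 a0 b0 amin.
have n1 : 1 <= n%:R :> R by rewrite ler1n.
have m0 : 0 <= m%:R :> R by [].
have := amin ((a + b) / 2); have -> : 0 <= (a + b) / 2 by lra.
move=> /(_ isT).
have : m%:R * mean_sqdist ((a + b) / 2) <=
       m%:R * ((mean_sqdist a + mean_sqdist b) / 2).
  by apply: ler_wpM2l => //; exact: mean_sqdist_mid.
have : (b - a) ^+ 2 <= n%:R * (b - a) ^+ 2 by rewrite ler_peMl// sqr_ge0.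
rewrite /block_cost.
move: (mean_sqdist _) (mean_sqdist _) (mean_sqdist _) (mean_sqdist _).
move=> p q r s.
have -> : n%:R * (b - a) ^+ 2 =
  2 * (n%:R * a ^+ 2) + 2 * (n%:R * b ^+ 2) - 4 * (n%:R * ((a + b) / 2) ^+ 2).
  by field.
lra.
Qed.

(** Near 0 the linear gain of [mean_sqdist_decrease] beats the quadratic loss
    [(n + m) * a ^+ 2]; the witness [a] balances the two. *)
Lemma block_cost_min_neq0 (R : realType) (n m : nat) : (0 < m)%N ->
  ~ (forall b : R, 0 <= b -> block_cost n m 0 <= block_cost n m b).
Proof.
move=> m0 min0.
have m1 : 1 <= m%:R :> R by rewrite ler1n.
have n0 : 0 <= n%:R :> R by [].
have := mean_abs_normal_prob_gt0 R.
have dec (a : R) := @mean_sqdist_decrease R a.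
move: (Rintegral _ _ _) dec => K dec K0.
pose a : R := K / (n%:R + m%:R).
have a0 : 0 < a by rewrite divr_gt0//; lra.
have aK : a * (n%:R + m%:R) = K by rewrite divfK// gt_eqF//; lra.
have := min0 a (ltW a0); have := dec a (ltW a0).
rewrite /block_cost expr0n addr0.
move: (mean_sqdist a) (mean_sqdist 0) => r r0 h1 h2; clearbody a.
have h3 : m%:R * r <= m%:R * (r0 - 2 * a * K + a ^+ 2).
  by rewrite ler_pM2l//; lra.
have h4 : (n%:R + m%:R) * a ^+ 2 = a * K by rewrite -aK; ring.
have aKp : 0 < a * K by rewrite mulr_gt0.
have h5 : a * K <= m%:R * (a * K) by rewrite ler_peMl// ltW.
lra.
Qed.

(** * Distance to the dilated subdifferential *)

(** The weighted norm is separable. For the forward direction it suffices to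
    perturb one coordinate: by [1] and [-1] where [x0] vanishes, and elsewhere
    by [x0 0 j] and its opposite, which pins the product [p 0 j * x0 0 j]. *)
Lemma subdifferential_wnorm1P (R : realType) (n : nat) (w x0 p : 'rV[R]_n) :
  (forall j, 0 <= w 0 j) ->
  subdifferential (wnorm1 w) x0 p <->
  forall j, `|p 0 j| <= w 0 j /\
    (x0 0 j != 0 -> p 0 j = w 0 j * Num.sg (x0 0 j)).
Proof.
move=> w0; split => [sub j|Hp v]; last first.
  rewrite /wnorm1 /dotp -big_split/=; apply: ler_sum => j _.
  have [plew psg] := Hp j; rewrite mxE.
  have [z0|nz] := eqVneq (x0 0 j) 0.
    rewrite z0 normr0 mulr0 !add0r (le_trans (ler_norm _))// normrM.
    exact: ler_wpM2r.
  rewrite [X in w 0 j * X + _]normrEsg.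
  rewrite psg//.
  rewrite [leLHS](_ : _ = w 0 j * (Num.sg (x0 0 j) * (x0 0 j + v 0 j))).
    2: by ring.
  apply: ler_wpM2l => //; rewrite (le_trans (ler_norm _))// normrM.
  by rewrite normr_sg nz mul1r.
have coord (t : R) : w 0 j * `|x0 0 j| + p 0 j * t <= w 0 j * `|x0 0 j + t|.
  have := sub (t *: delta_mx 0 j).
  rewrite /wnorm1 /dotp (bigD1 j)//= [X in _ + X](bigD1 j)//=.
  rewrite [leRHS](bigD1 j)//=.
  rewrite !mxE !eqxx !mulr1.
  rewrite [X in _ + (_ + X)]big1; last first.
    by move=> i /negbTE ij; rewrite !mxE ij andbF !mulr0.
  rewrite [X in _ <= _ + X](eq_bigr (fun i => w 0 i * `|x0 0 i|)); last first.
    by move=> i /negbTE ij; rewrite !mxE ij andbF mulr0 addr0.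
  by rewrite addr0 addrAC lerD2r.
have [z0|nz] := eqVneq (x0 0 j) 0.
  split => //; have := coord 1; have := coord (-1).
  rewrite z0 normr0 mulr0 !add0r normrN normr1 mulr1 => h1 h2.
  by rewrite ler_norml; apply/andP; split; lra.
have ppx : p 0 j * x0 0 j = w 0 j * `|x0 0 j|.
  have := coord (x0 0 j); have := coord (- x0 0 j).
  rewrite subrr normr0 -mulr2n normrMn mulrnAr; lra.
have pE : p 0 j = w 0 j * Num.sg (x0 0 j).
  by apply: (mulIf nz); rewrite ppx -mulrA -normrEsg.
by split => // ; rewrite pE normrM normr_sg nz mulr1 ger0_norm.
Qed.

(** The squared distance from [x] to the [j]-th projection of the dilated
    subdifferential, for [s] the [j]-th coordinate of [x0] and [a] the dilated
    weight: a point if [s] is nonzero, a segment otherwise. *)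
Definition coord_cost (R : realType) (s a x : R) : R :=
  if s != 0 then (x - a * Num.sg s) ^+ 2 else sqdist_seg a x.

Lemma coord_cost_ge0 (R : realType) (s a x : R) : 0 <= coord_cost s a x.
Proof. by rewrite /coord_cost; case: ifP => _; exact: sqr_ge0. Qed.

Lemma coord_cost_le (R : realType) (s a x y : R) :
  `|y| <= a -> (s != 0 -> y = a * Num.sg s) -> coord_cost s a x <= (x - y) ^+ 2.
Proof.
rewrite /coord_cost; case: ifPn => [_ _ -> //|_ ya _].
rewrite /sqdist_seg -[leRHS](real_normK (num_real _)) lerXn2r ?nnegrE//.
  by rewrite le_max lexx.
rewrite ge_max normr_ge0/=.
have := lerB_dist x y; lra.
Qed.

Lemma coord_cost_attained (R : realType) (s a x : R) : 0 <= a ->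
  exists y, [/\ `|y| <= a, s != 0 -> y = a * Num.sg s &
    coord_cost s a x = (x - y) ^+ 2].
Proof.
move=> a0; rewrite /coord_cost; have [->|s0] := eqVneq s 0; last first.
  exists (a * Num.sg s); split => //.
  by rewrite normrM normr_sg s0 mulr1 ger0_norm.
rewrite /sqdist_seg; have [xa|ax] := leP (`|x|) a.
  by exists x; split => //; rewrite subrr max_l// subr_le0.
exists (a * Num.sg x); split => //.
  rewrite normrM (ger0_norm a0) normr_sg -[leRHS]mulr1 ler_wpM2l//.
  by case: (x != 0).
rewrite max_r ?subr_ge0 ?ltW//.
have x0 : x != 0 by rewrite -normr_gt0; exact: le_lt_trans a0 ax.
rewrite [in RHS](_ : x - a * Num.sg x = Num.sg x * (`|x| - a)).
  by rewrite exprMn sqr_sg x0 mul1r.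
by rewrite mulrBr -numEsg [a * _]mulrC.
Qed.

Lemma eucl_dist_sqrE (R : realType) (n : nat) (x p : 'rV[R]_n)
    (M : set 'rV[R]_n) :
  M p -> (forall q, M q ->
    \sum_(j < n) (x 0 j - p 0 j) ^+ 2 <= \sum_(j < n) (x 0 j - q 0 j) ^+ 2) ->
  eucl_dist x M ^+ 2 = \sum_(j < n) (x 0 j - p 0 j) ^+ 2.
Proof.
move=> Mp pmin.
have normE (q : 'rV[R]_n) :
    eucl_norm (x - q) = Num.sqrt (\sum_(j < n) (x 0 j - q 0 j) ^+ 2).
  by congr Num.sqrt; apply: eq_bigr => j _; rewrite !mxE.
suff -> : eucl_dist x M = eucl_norm (x - p).
  by rewrite normE sqr_sqrtr// sumr_ge0// => j _; exact: sqr_ge0.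
have lbp : lbound [set eucl_norm (x - q) | q in M] (eucl_norm (x - p)).
  by move=> _ [q Mq <-]; rewrite !normE ler_wsqrtr// pmin.
apply/eqP; rewrite eq_le; apply/andP; split.
  by apply: ge_inf; [exists (eucl_norm (x - p))|exists p].
by apply: lb_le_inf => //; exists (eucl_norm (x - p)), p.
Qed.

(** The dilated subdifferential is a box, so the nearest point is found
    coordinate by coordinate. *)
Lemma eucl_dist_dilate_subdifferential (R : realType) (n : nat)
    (w x0 x : 'rV[R]_n) (tau : R) : 0 < tau -> (forall j, 0 <= w 0 j) ->
  eucl_dist x (dilate tau (subdifferential (wnorm1 w) x0)) ^+ 2 =
  \sum_(j < n) coord_cost (x0 0 j) (tau * w 0 j) (x 0 j).
Proof.
move=> tau0 w0.
have tw0 j : 0 <= tau * w 0 j by rewrite mulr_ge0// ltW.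
have [y Hy] := choice (fun j => coord_cost_attained (x0 0 j) (x 0 j) (tw0 j)).
pose p : 'rV[R]_n := \row_j (tau^-1 * y j).
have pE j : (tau *: p) 0 j = y j by rewrite !mxE mulrA divff ?mul1r// gt_eqF.
have -> : \sum_(j < n) coord_cost (x0 0 j) (tau * w 0 j) (x 0 j) =
          \sum_(j < n) (x 0 j - (tau *: p) 0 j) ^+ 2.
  by apply: eq_bigr => j _; rewrite pE; have [] := Hy j.
apply: eucl_dist_sqrE.
  exists p => //; apply/subdifferential_wnorm1P => // j.
  have [ya ys _] := Hy j; rewrite mxE; split => [|/ys ->].
    by rewrite normrM gtr0_norm ?invr_gt0// mulrC ler_pdivrMr// mulrC.
  by rewrite !mulrA mulVf ?mul1r// gt_eqF.
move=> _ [q /(subdifferential_wnorm1P _ _ w0) qsub <-].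
apply: ler_sum => j _; rewrite pE; have [_ _ <-] := Hy j.
have [qw qs] := qsub j; apply: coord_cost_le; rewrite mxE.
  by rewrite normrM gtr0_norm// ler_pM2l.
by move=> /qs ->; rewrite mulrA.
Qed.

(** * Expected squared distance *)

Definition mean_coord_cost (R : realType) (s a : R) : R :=
  if s != 0 then mean_sqdist 0 + a ^+ 2 else mean_sqdist a.

Lemma integral_coord_cost (R : realType) (s a : R) : 0 <= a ->
  (\int[@normal_prob R 0 1]_x (coord_cost s a x)%:E =
   (mean_coord_cost s a)%:E)%E.
Proof.
move=> a0; rewrite /coord_cost /mean_coord_cost; case: ifPn => s0; last first.
  by rewrite [RHS]fineK//; exact: integrable_fin_num (integrable_sqdist_seg a0).
have -> : a ^+ 2 = (a * Num.sg s) ^+ 2 by rewrite exprMn sqr_sg s0 mulr1.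
rewrite -mean_sqr_shift [RHS]fineK//; apply: integrable_fin_num => //.
set b := a * _.
have iG : (@normal_prob R 0 1).-integrable [set: R]
    (cst (2 * b ^+ 2)%:E \+ (fun x : R => 2%:E * (x ^+ 2)%:E))%E.
  apply: integrableD => //; first exact: finite_measure_integrable_cst.
  by apply: integrableZl => //; exact: integrable_sqr_normal_prob.
apply: le_integrable iG => //.
- by apply/measurable_EFinP; apply: measurable_funX; exact: measurable_funB.
- move=> x _; rewrite /= lee_fin ger0_norm ?sqr_ge0// ger0_norm; last first.
    by rewrite addr_ge0// mulr_ge0// sqr_ge0.
  by have := sqr_ge0 (x + b); clear; move=> ?; nra.
Qed.

Lemma measurable_coord_cost (R : realType) (s a : R) :
  measurable_fun [set: R] (coord_cost s a).
Proof.
rewrite /coord_cost; case: (s != 0); last exact: measurable_sqdist_seg.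
by apply: measurable_funX; exact: measurable_funB.
Qed.

(** The squared distance is a sum over coordinates, so linearity reduces its
    mean to integrals against the common law of the coordinates of [g]. *)
Lemma expectation_dist_dilate (R : realType) (disp : measure_display)
    (Omega : measurableType disp) (P : probability Omega R) (n : nat)
    (g : 'I_n -> {RV P >-> R}) (x0 w : 'rV[R]_n) (tau : R) :
  standard_gaussian g -> 0 < tau -> (forall j, 0 <= w 0 j) ->
  ('E_P[(fun t : Omega => n%:R^-1 * eucl_dist (vec_of g t)
          (dilate tau (subdifferential (wnorm1 w) x0)) ^+ 2)%R] =
   (n%:R^-1 * \sum_(j < n) mean_coord_cost (x0 0 j) (tau * w 0 j))%:E)%E.
Proof.
move=> [law _] tau0 w0; rewrite unlock.
have tw0 j : 0 <= tau * w 0 j by rewrite mulr_ge0// ltW.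
pose c j (t : Omega) := (coord_cost (x0 0 j) (tau * w 0 j) (g j t))%:E.
have mc j : measurable_fun [set: Omega] (c j).
  apply/measurable_EFinP.
  by apply: measurableT_comp => //; exact: measurable_coord_cost.
have c0 j t : (0 <= c j t)%E by rewrite lee_fin coord_cost_ge0.
transitivity (\int[P]_t (n%:R^-1%:E * \sum_(j < n) c j t))%E.
  apply: eq_integral => t _; rewrite eucl_dist_dilate_subdifferential//.
  rewrite EFinM -sumEFin; congr (_ * _)%E; apply: eq_bigr => j _.
  by rewrite mxE.
rewrite ge0_integralZl//=; last 2 first.
- exact: emeasurable_sum.
- by move=> t _; apply: sume_ge0 => j _; exact: c0.
rewrite ge0_integral_sum// EFinM -sumEFin; congr (_ * _)%E.
apply: eq_bigr => j _; rewrite -integral_coord_cost//.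
transitivity (\int[distribution P (g j)]_x
    (coord_cost (x0 0 j) (tau * w 0 j) x)%:E)%E.
  rewrite ge0_integral_distribution//.
  - by apply/measurable_EFinP; exact: measurable_coord_cost.
  - by move=> y; rewrite lee_fin coord_cost_ge0.
(* The laws of the g j live on R with its Borel structure and normal_prob on an
   isomorphic copy of it; the identity carries one to the other. *)
pose idR : measurableTypeR R -> R := idfun.
have midR : measurable_fun [set: measurableTypeR R] idR.
  by move=> _ A mA; rewrite setTI.
transitivity (\int[pushforward (@normal_prob R 0 1) idR]_x
    (coord_cost (x0 0 j) (tau * w 0 j) x)%:E)%E.
  by apply: eq_measure_integral => A mA _; exact: law.
rewrite ge0_integral_pushforward//.
- by apply/measurable_EFinP; exact: measurable_coord_cost.
- by move=> y _; rewrite lee_fin coord_cost_ge0.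
Qed.

(** * Minimizing infima along rays *)

Lemma sqr_norm_le_coord (R : realType) (k : nat) (x : 'rV[R]_k) (B : R) :
  0 <= B -> (forall i, x 0 i ^+ 2 <= B) -> `|x| ^+ 2 <= B.
Proof.
move=> B0 xB; have [->|x0] := eqVneq x 0; first by rewrite normr0 expr0n.
have [[a i]] : exists i, `|x| = `|x i.1 i.2|.
  by apply: mx_norm_neq0; rewrite -[mx_norm x]/(`|x|) normr_eq0.
by rewrite /= ord1 => ->; rewrite real_normK ?num_real.
Qed.

(** Quadratic growth of [F] at [u] makes the infimum of [F] over the open ray
    through [v] reach the value [F u] only if the ray comes arbitrarily close to
    [u]. When [v] has norm 1 and [tau *: v] is close to [u], the scalar [tau] is
    close to the norm of [u], which forces [`|u| *: v = u]. *)
Lemma unique_normalized_ray_minimizer (R : realType) (k : nat)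
    (F : 'rV[R]_k -> R) (c : R) (u : 'rV[R]_k) (m : 'rV[R]_k -> \bar R) :
  0 < c -> nonneg_vec u -> u != 0 ->
  (forall v, nonneg_vec v -> F u + c * `|v - u| ^+ 2 <= F v) ->
  (forall v, nonneg_vec v ->
     m v = ereal_inf [set (F (tau *: v))%:E | tau in [set tau | 0 < tau]]) ->
  let optimal v := nonneg_vec v /\
    forall v', nonneg_vec v' -> (m v <= m v')%E in
  (exists v, optimal v) /\ (exists! v, optimal v /\ `|v| = 1).
Proof.
move=> c0 u0 unz grow mE optimal.
have nu0 : 0 < `|u| by rewrite normr_gt0.
have scale_nonneg (t : R) (v : 'rV[R]_k) :
    0 < t -> nonneg_vec v -> nonneg_vec (t *: v).
  by move=> t0 v0 i; rewrite mxE mulr_ge0// ltW.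
have m_ge v : nonneg_vec v -> ((F u)%:E <= m v)%E.
  move=> v0; rewrite mE//; apply: le_ereal_inf_tmp => _ [tau /= tau0 <-].
  rewrite lee_fin (le_trans _ (grow _ (scale_nonneg _ _ tau0 v0)))//.
  by rewrite lerDl mulr_ge0 ?sqr_ge0 ?ltW.
have m_le t : 0 < t -> (m (t *: u) <= (F u)%:E)%E.
  move=> t0; rewrite mE; last exact: scale_nonneg.
  apply: ereal_inf_lbound; exists t^-1; first by rewrite /= invr_gt0.
  by rewrite scalerA mulVf ?gt_eqF// scale1r.
have ray_optimal t : 0 < t -> optimal (t *: u).
  move=> t0; split; first exact: scale_nonneg.
  by move=> v v0; apply: le_trans (m_le _ t0) (m_ge _ v0).
split; first by exists (1 *: u); exact: ray_optimal.
exists (`|u|^-1 *: u); split.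
  split; first by apply: ray_optimal; rewrite invr_gt0.
  by rewrite normrZ normfV normr_id mulVf// gt_eqF.
move=> v [[v0 vopt] v1].
suff /eqP : `|u| *: v - u = 0.
  rewrite subr_eq0 => /eqP uv.
  by rewrite -uv scalerA uv mulVf ?scale1r// gt_eqF.
apply/eqP; rewrite -normr_le0; apply/ler_addgt0Pl => e e0; rewrite addr0.
have : (m v < (F u + c * (e / 2) ^+ 2)%:E)%E.
  apply: le_lt_trans (vopt _ u0) _.
  rewrite -[u in m u]scale1r (le_lt_trans (m_le _ ltr01))// lte_fin ltrDl.
  by rewrite mulr_gt0// exprn_gt0// divr_gt0.
rewrite mE// => /ereal_inf_lt[_ [tau /= tau0 <-]]; rewrite lte_fin => Flt.
have close : `|tau *: v - u| < e / 2.
  rewrite -(@ltr_pXn2r _ 2) ?nnegrE ?divr_ge0 ?(ltW e0)//.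
  rewrite -(ltr_pM2l c0) -(ltrD2l (F u)).
  exact: le_lt_trans (grow _ (scale_nonneg _ _ tau0 v0)) Flt.
have -> : `|u| *: v - u = (`|u| - tau) *: v + (tau *: v - u).
  by rewrite scalerBl addrA subrK.
apply: le_trans (ler_normD _ _) _; rewrite normrZ v1 mulr1.
have : `| `|u| - tau | <= `|tau *: v - u|.
  have tauE : tau = `|tau *: v| by rewrite normrZ v1 mulr1 gtr0_norm.
  by rewrite {1}tauE distrC; exact: ler_dist_dist.
by move: close; lra.
Qed.

(** * Optimal weights *)

Lemma partition_indexP (d k : nat) (S : 'I_k -> set 'I_d) :
  partition [set: 'I_k] S [set: 'I_d] ->
  exists ix : 'I_d -> 'I_k, forall i j, S i j <-> ix j = i.
Proof.
move=> [cov triv _].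
have ex j : exists i, S i j.
  have : cover [set: 'I_k] S j by rewrite cov.
  by move=> [i _ Sij]; exists i.
have [ix Hix] := choice ex; exists ix => i j; split => [Sij|<- //].
by apply: triv => //; exists j.
Qed.

Lemma weight_vecE (R : realType) (d k : nat) (S : 'I_k -> set 'I_d)
    (ix : 'I_d -> 'I_k) (omega : 'rV[R]_k) (j : 'I_d) :
  (forall i j, S i j <-> ix j = i) ->
  weight_vec S omega 0 j = omega 0 (ix j).
Proof.
move=> ixP; rewrite /weight_vec summxE (bigD1 (ix j))//= big1 ?addr0.
  by rewrite !mxE indicE mem_set ?mulr1//; apply/ixP.
move=> i /eqP ij; rewrite !mxE indicE memNset ?mulr0//.
by move/ixP => /esym.
Qed.

(** Grouping by blocks separates the variables, so each scaled weight can be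
    minimized on its own. *)
Lemma sum_mean_coord_cost (R : realType) (d k : nat) (ix : 'I_d -> 'I_k)
    (x0 : 'rV[R]_d) (u : 'rV[R]_k) :
  \sum_(j < d) mean_coord_cost (x0 0 j) (u 0 (ix j)) =
  \sum_(i < k) block_cost #|[pred j | (ix j == i) && (x0 0 j != 0)]|
                          #|[pred j | (ix j == i) && ~~ (x0 0 j != 0)]| (u 0 i).
Proof.
rewrite (partition_big ix xpredT)//=; apply: eq_bigr => i _.
rewrite (bigID (fun j => x0 0 j != 0))/= /block_cost; congr (_ + _).
  rewrite (eq_bigr (fun=> mean_sqdist 0 + u 0 i ^+ 2)).
    by rewrite sumr_const mulr_natl.
  by move=> j /andP[/eqP <- nz]; rewrite /mean_coord_cost nz.
rewrite (eq_bigr (fun=> mean_sqdist (u 0 i))).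
  by rewrite sumr_const mulr_natl.
by move=> j /andP[/eqP <- /negbTE nz]; rewrite /mean_coord_cost nz.
Qed.

Theorem theorem10 (R : realType) (disp : measure_display)
    (Omega : measurableType disp) (P : probability Omega R)
    (d k : nat) (g : 'I_d -> {RV P >-> R})
    (hg : standard_gaussian g)
    (T : set 'I_d) (hT : T `<` [set: 'I_d])
    (x0 : 'rV[R]_d) (hx0 : supp x0 = T)
    (S : 'I_k -> set 'I_d)
    (hS : partition [set: 'I_k] S [set: 'I_d])
    (hST : forall i : 'I_k, S i `&` T !=set0) :
  (exists omega : 'rV[R]_k, optimal_weights g x0 S omega) /\
  (exists! omega : 'rV[R]_k, optimal_weights g x0 S omega /\ `|omega| = 1).
Proof.
have [ix ixP] := partition_indexP hS.
have [j0 j0T] : exists j, ~ T j.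
  apply: contrapT => nex; apply: hT.2 => j _.
  by apply: contrapT => Tj; apply: nex; exists j.
have x0j0 : x0 0 j0 == 0 by apply: contra_notT j0T => nz; rewrite -hx0.
have d0 : 0 < d%:R :> R by rewrite ltr0n (leq_ltn_trans _ (ltn_ord j0)).
pose nT i := #|[pred j | (ix j == i) && (x0 0 j != 0)]|.
pose nC i := #|[pred j | (ix j == i) && ~~ (x0 0 j != 0)]|.
have nT0 i : (0 < nT i)%N.
  have [j [/ixP Sij Tj]] := hST i; apply/card_gt0P; exists j.
  by rewrite inE Sij eqxx /=; move: Tj; rewrite -hx0.
have nC0 : (0 < nC (ix j0))%N.
  by apply/card_gt0P; exists j0; rewrite inE eqxx x0j0.
have blockmin i : exists a : R, 0 <= a /\
    forall b, 0 <= b ->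
      block_cost (nT i) (nC i) a <= block_cost (nT i) (nC i) b.
  by have [a ? ?] := @block_cost_min R _ (nC i) (nT0 i); exists a.
have [a amin] := choice blockmin.
pose u : 'rV[R]_k := \row_i a i.
pose F (v : 'rV[R]_k) : R :=
  d%:R^-1 * \sum_(i < k) block_cost (nT i) (nC i) (v 0 i).
apply: (@unique_normalized_ray_minimizer R k F (d%:R^-1 / 2) u
  (fun omega => mtilde g x0 (weight_vec S omega))).
- by rewrite divr_gt0 ?invr_gt0.
- by move=> i; rewrite mxE; have [] := amin i.
- apply/eqP => /rowP /(_ (ix j0)); rewrite !mxE => a0.
  by have [_] := amin (ix j0); rewrite a0; exact: block_cost_min_neq0.
- move=> v v0; rewrite /F -mulrA -mulrDr ler_wpM2l ?invr_ge0 ?(ltW d0)//.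
  set D := \sum_i _; set E := \sum_i _.
  suff : `|v - u| ^+ 2 <= 2 * (E - D) by lra.
  have term i : (v 0 i - a i) ^+ 2 <=
      2 * (block_cost (nT i) (nC i) (v 0 i) - block_cost (nT i) (nC i) (u 0 i)).
    have [ai0 imin] := amin i.
    have := block_cost_growth (nT0 i) ai0 (v0 i) imin.
    by rewrite [u 0 i]mxE; lra.
  have sumE : 2 * (E - D) = \sum_i 2 * (block_cost (nT i) (nC i) (v 0 i) -
      block_cost (nT i) (nC i) (u 0 i)) by rewrite -mulr_sumr sumrB.
  have term0 i := le_trans (sqr_ge0 _) (term i).
  apply: sqr_norm_le_coord => [|i]; first by rewrite sumE sumr_ge0.
  rewrite sumE (bigD1 i)//= !mxE; apply: le_trans (term i) _.
  by rewrite mxE lerDl sumr_ge0.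
- move=> v v0; rewrite /mtilde; congr ereal_inf.
  have wv j : 0 <= weight_vec S v 0 j by rewrite (weight_vecE _ _ ixP).
  have costE tau : 0 < tau ->
    ('E_P[(fun t : Omega => d%:R^-1 * eucl_dist (vec_of g t)
       (dilate tau (subdifferential (wnorm1 (weight_vec S v)) x0)) ^+ 2)%R] =
     (F (tau *: v))%:E)%E.
    move=> tau0; rewrite expectation_dist_dilate//; congr (_ * _)%:E.
    rewrite -sum_mean_coord_cost; apply: eq_bigr => j _.
    by rewrite (weight_vecE _ _ ixP) mxE.
  by apply/seteqP; split => _ [tau tau0 <-]; exists tau => //; rewrite costE.
Qed.
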